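(* Let $d\ge 1$ and let $Q=(q_1,\dots,q_{d+1})$ and $Q'=(q_1',\dots,q_{d+1}')$ be sequences of $d+1$ points in $\mathbb{R}^d$. Let $o\in\mathbb{R}^d$ and let $\Pi$ be an oriented hyperplane passing through $o$ such that: $Q\cup Q'\cup\{o\}$ is in general position; no point of $Q$ or $Q'$ lies on $\Pi$; and $o\in\operatorname{conv}(Q)$. Let $\pi_o$ be the signed central projection from $o$ with respect to $\Pi$ (and a hyperplane $\Pi'$ parallel to $\Pi$). Suppose that (i) $(\pi_o(q_1),\dots,\pi_o(q_{d+1}))\simeq(\pi_o(q_1'),\dots,\pi_o(q_{d+1}'))$ as sequences of points in $\mathbb{R}^{d-1}$; and (ii) $\operatorname{sgn}(\pi_o(q_i))=\operatorname{sgn}(\pi_o(q_i'))$ for every $1\le i\le d+1$. Then (1) $o\in\operatorname{conv}(Q')$; and (2) $Q\simeq Q'$.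
   Context: A set of points in $\mathbb{R}^d$ is in general position if no $j\le d+1$ of them lie in a common $(j-2)$-flat. The orientation of a $(d+1)$-tuple of points in $\mathbb{R}^d$ is $\chi(p_1,\dots,p_{d+1})=\operatorname{sgn}\det M$, where $M$ is the $(d+1)\times(d+1)$ matrix whose $i$-th row is $(1,p_i(1),\dots,p_i(d))$, with $p_i(j)$ the $j$-th coordinate of $p_i$. The same definition with $d-1$ in place of $d$ gives the orientation of $d$-tuples in $\mathbb{R}^{d-1}$. Two sequences $\sigma,\tau$ of $m$ points in $\mathbb{R}^e$ have the same labelled order type, $\sigma\simeq\tau$, if $\chi(\sigma(i_1),\dots,\sigma(i_{e+1}))=\chi(\tau(i_1),\dots,\tau(i_{e+1}))$ for all $1\le i_1<\cdots<i_{e+1}\le m$. Signed central projection: let $\Pi$ be an oriented hyperplane through $o\in\mathbb{R}^d$ with unit normal $\nu$ pointing to its positive side (''above'' $\Pi$), and let $\Pi'=\Pi+h\nu$ with $h>0$ be a parallel hyperplane, identified with $\mathbb{R}^{d-1}$ via the origin $o+h\nu$ and an orthonormal basis $e_1,\dots,e_{d-1}$ of the direction space of $\Pi$ such that $(e_1,\dots,e_{d-1},\nu)$ is a positively oriented basis of $\mathbb{R}^d$. For $q\in\mathbb{R}^d\setminus\Pi$, let $\ell_q$ be the line through $o$ and $q$; then $\pi_o(q)\in\mathbb{R}^{d-1}$ is the point of $\ell_q\cap\Pi'$, and it carries a sign $\operatorname{sgn}(\pi_o(q)):=+1$ if $q$ is above $\Pi$ and $-1$ if $q$ is below $\Pi$.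 (For $o=0$, $\Pi=\{x_d=0\}$, $\Pi'=\{x_d=1\}$ this is $\pi_o(q)=(q(1)/q(d),\dots,q(d-1)/q(d))$ with sign $\operatorname{sgn}(q(d))$.) *)

(* Defs.v *)
From mathcomp Require Import all_boot all_order all_algebra.
From mathcomp Require Import reals.

Set Implicit Arguments.
Unset Strict Implicit.
Unset Printing Implicit Defensive.

Import Order.TTheory GRing.Theory Num.Theory.
Local Open Scope ring_scope.

Section Points.
Variable R : realType.

Definition dotv d (u v : 'rV[R]_d) : R := \sum_(i < d) u 0 i * v 0 i.

Definition flat d (p : 'rV[R]_d) (W : {vspace 'rV[R]_d}) : {pred 'rV[R]_d} :=
  [pred x | x - p \in W].

(* The list S stands for the set of its elements, so repetitions in S are
   irrelevant.  Here k = j - 2; the case j = 1 is omitted since the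
   (-1)-flat is empty. *)
Definition general_position d (S : seq 'rV[R]_d) : Prop :=
  forall (k : nat) (s : seq 'rV[R]_d),
    (k.+2 <= d.+1)%N -> uniq s -> size s = k.+2 -> {subset s <= S} ->
    ~ exists (p : 'rV[R]_d) (W : {vspace 'rV[R]_d}),
        \dim W = k /\ {subset s <= flat p W}.

Definition orientation e (p : 'I_e.+1 -> 'rV[R]_e) : R :=
  Num.sg (\det (\matrix_(i < e.+1) (row_mx 1%:M (p i) : 'rV[R]_e.+1))).

Definition same_order_type e m (s t : 'I_m -> 'rV[R]_e) : Prop :=
  forall f : 'I_e.+1 -> 'I_m,
    (forall i j : 'I_e.+1, (i < j)%N -> (f i < f j)%N) ->
    orientation (fun i => s (f i)) = orientation (fun i => t (f i)).

Definition in_conv d m (x : 'rV[R]_d) (q : 'I_m -> 'rV[R]_d) : Prop :=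
  exists w : 'I_m -> R,
    [/\ forall i, 0 <= w i, \sum_i w i = 1 & x = \sum_i w i *: q i].

(* The hyperplane through o with unit normal nu is the zero set of height o nu,
   and its positive side is where height o nu is positive. *)
Definition height d (o nu x : 'rV[R]_d) : R := dotv (x - o) nu.

Definition frame_mx n (nu : 'rV[R]_n.+1) (e : 'I_n -> 'rV[R]_n.+1) :
    'M[R]_n.+1 :=
  \matrix_(i < n.+1) (if unlift ord_max i is Some k then e k else nu).

(* When n = 0 the family e is empty, so it cannot be chosen to make the
   orientation positive; both orientations of the hyperplane are then allowed. *)
Definition oriented_frame n (nu : 'rV[R]_n.+1) (e : 'I_n -> 'rV[R]_n.+1) :
    Prop :=
  [/\ dotv nu nu = 1,
      forall k l, dotv (e k) (e l) = (k == l)%:R,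
      forall k, dotv (e k) nu = 0
    & (0 < n)%N -> 0 < \det (frame_mx nu e)].

(* The point of height h on the line through o and q, in the coordinates of the
   hyperplane of height h with origin o + h nu and basis e; meaningful only when
   height o nu q != 0, see central_projP. *)
Definition central_proj n (o nu : 'rV[R]_n.+1) (e : 'I_n -> 'rV[R]_n.+1)
    (h : R) (q : 'rV[R]_n.+1) : 'rV[R]_n :=
  let x := o + (h / height o nu q) *: (q - o) in
  \row_(k < n) dotv (x - (o + h *: nu)) (e k).

Definition proj_sign d (o nu q : 'rV[R]_d) : R := Num.sg (height o nu q).

Lemma dotvE d (u v : 'rV[R]_d) : dotv u v = (u *m v^T) 0 0.
Proof. by rewrite mxE; apply: eq_bigr => i _; rewrite mxE. Qed.

Lemma dotvC d (u v : 'rV[R]_d) : dotv u v = dotv v u.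
Proof. by apply: eq_bigr => i _; rewrite mulrC. Qed.

Lemma dotvDl d (u v w : 'rV[R]_d) : dotv (u + v) w = dotv u w + dotv v w.
Proof. by rewrite !dotvE mulmxDl mxE. Qed.

Lemma dotvZl d a (u w : 'rV[R]_d) : dotv (a *: u) w = a * dotv u w.
Proof. by rewrite !dotvE -scalemxAl mxE. Qed.

Lemma dotv_suml d m (u : 'I_m -> 'rV[R]_d) w :
  dotv (\sum_i u i) w = \sum_i dotv (u i) w.
Proof.
rewrite dotvE mulmx_suml summxE.
by apply: eq_bigr => i _; rewrite dotvE.
Qed.

Lemma frame_decomp n (nu : 'rV[R]_n.+1) (e : 'I_n -> 'rV[R]_n.+1) v :
  oriented_frame nu e ->
  v = \sum_k dotv v (e k) *: e k + dotv v nu *: nu.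
Proof.
case=> nu1 ee enu _.
have liftE k : lift ord_max k = widen_ord (leqnSn n) k.
  by apply: val_inj; rewrite /= /bump leqNgt ltn_ord.
have FF : frame_mx nu e *m (frame_mx nu e)^T = 1%:M.
  apply/matrixP=> i j; rewrite !mxE.
  transitivity (dotv (row i (frame_mx nu e)) (row j (frame_mx nu e))).
    by apply: eq_bigr => k _; rewrite !mxE.
  rewrite !rowK; case: unliftP => [k ->|->]; case: unliftP => [l ->|->].
  - by rewrite ee (inj_eq lift_inj).
  - by rewrite enu eq_sym (negPf (neq_lift _ _)).
  - by rewrite dotvC enu (negPf (neq_lift _ _)).
  - by rewrite nu1 eqxx.
rewrite -{1}[v]mulmx1 -(mulmx1C FF) mulmxA mulmx_sum_row big_ord_recr /=.
have coE i : (v *m (frame_mx nu e)^T) 0 i = dotv v (row i (frame_mx nu e)).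
  by rewrite mxE; apply: eq_bigr => j _; rewrite !mxE.
congr (_ + _); last by rewrite coE !rowK unlift_none.
by apply: eq_bigr => k _; rewrite -liftE coE !rowK liftK.
Qed.

Lemma central_projP n (o nu : 'rV[R]_n.+1) (e : 'I_n -> 'rV[R]_n.+1) (h : R)
    (q : 'rV[R]_n.+1) (y : 'rV[R]_n) :
  oriented_frame nu e -> height o nu q != 0 ->
  (exists t : R, o + h *: nu + \sum_k y 0 k *: e k = o + t *: (q - o)) <->
  y = central_proj o nu e h q.
Proof.
move=> fr q0; have [nu1 ee enu _] := fr.
have sumE w : dotv (\sum_k y 0 k *: e k) w = \sum_k y 0 k * dotv (e k) w.
  by rewrite dotv_suml; apply: eq_bigr => k _; rewrite dotvZl.
split=> [[t]|->].
  rewrite -addrA => /addrI eqt.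
  have ht : h = t * height o nu q.
    rewrite -dotvZl -eqt dotvDl dotvZl nu1 sumE big1 ?addr0 ?mulr1 // => k _.
    by rewrite enu mulr0.
  apply/rowP=> k; rewrite mxE ht mulfK // -eqt.
  rewrite [o + _]addrC addrKA [h *: nu + _]addrC -ht addrK sumE.
  rewrite (bigD1 k) //= ee eqxx mulr1 big1 ?addr0 // => l /negPf lk.
  by rewrite ee lk mulr0.
exists (h / height o nu q).
set x := o + _; rewrite -[RHS](subrK (o + h *: nu)) [RHS]addrC; congr (_ + _).
rewrite [RHS](frame_decomp _ fr) [dotv _ nu](_ : _ = 0) ?scale0r ?addr0.
  by apply: eq_bigr => k _; rewrite mxE.
rewrite /x opprD addrACA subrr add0r dotvDl dotvZl -/(height o nu q).
by rewrite divfK // -scaleNr dotvZl nu1 mulr1 subrr.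
Qed.

End Points.

(* Main.v *)
Require Import Defs.
From mathcomp Require Import all_boot all_order all_algebra.
From mathcomp Require Import reals.

Set Implicit Arguments.
Unset Strict Implicit.
Unset Printing Implicit Defensive.

Import Order.TTheory GRing.Theory Num.Theory.
Local Open Scope ring_scope.

(* Translate so that o = 0 and let M be the matrix with rows (1, q_i - o).
   Multiplying the row (1, pi_o(q_k)) by the height of q_k gives, up to a fixed
   linear change of coordinates, the row q_k - o; so the projected order
   type and the signs determine the signs of the maximal minors of the q_i - o,
   i.e. of the cofactors of M along its first column.  A convex combination w
   giving o satisfies w M = (1, 0, ..., 0), hence cofactor k = det M * w_k: all
   cofactors have the (weak) sign of det M.  Then so do those of M', and
   det M', being their sum, has the same sign as det M; the normalised
   cofactors of M' are the convex weights for Q'. *)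

(** * Preliminaries on subspaces, increasing maps and translations *)

(** [general_position] speaks of flats of one exact dimension, so a span that is too small has to be
    enlarged; adjoining a vector outside the subspace raises the dimension by one. *)
Lemma vspace_dim_ext (K : fieldType) (vT : vectType K) (U : {vspace vT}) k :
  (\dim U <= k <= \dim {:vT})%N ->
  exists2 W : {vspace vT}, (U <= W)%VS & \dim W = k.
Proof.
elim: k => [|k IHk] /andP[].
  by rewrite leqn0 => /eqP dU _; exists U.
rewrite leq_eqVlt => /predU1P[dU _|]; first by exists U.
rewrite ltnS => dU dk.
have [|W UW dW] := IHk; first by rewrite dU ltnW.
have /subvPn[v _ vW] : ~~ (@fullv _ vT <= W)%VS.
  by apply: contraL dk => /dimvS; rewrite dW -leqNgt.
exists (W + <[v]>)%VS; first exact: subv_trans UW (addvSl _ _).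
rewrite dimv_disjoint_sum ?dW ?dim_vline.
  by case: eqP vW => [->|_]; rewrite ?mem0v ?addn1.
apply/eqP; rewrite -subv0; apply/subvP=> x; rewrite memv_cap => /andP[xW].
case/vlineP=> a xE; rewrite xE in xW *.
have [->|a0] := eqVneq a 0; first by rewrite scale0r mem0v.
by rewrite rpredZeq (negPf a0) (negPf vW) in xW.
Qed.

Lemma incr_ord_ge n (f : 'I_n -> 'I_n) :
  (forall i j : 'I_n, (i < j)%N -> (f i < f j)%N) ->
  forall i : 'I_n, (i <= f i)%N.
Proof.
move=> f_incr [i]; elim: i => // i IHi i_lt.
exact: leq_ltn_trans (IHi (ltnW i_lt)) (f_incr (Ordinal _) (Ordinal _) (ltnSn i)).
Qed.

(** The bound [i <= f i], applied also to [f] conjugated by [rev_ord], gives both inequalities.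
    Hence the order type of [d.+1] points in dimension [d] is a single orientation. *)
Lemma incr_ord_id n (f : 'I_n -> 'I_n) :
  (forall i j : 'I_n, (i < j)%N -> (f i < f j)%N) -> f =1 id.
Proof.
move=> f_incr i; apply/val_inj/eqP; rewrite eqn_leq (incr_ord_ge f_incr) andbT.
have /(_ (rev_ord i)) : forall j : 'I_n, (j <= rev_ord (f (rev_ord j)))%N.
  apply: (incr_ord_ge (f := fun j => rev_ord (f (rev_ord j)))) => j k jk.
  by rewrite ltn_sub2lE //= ltnS f_incr //= ltn_sub2lE.
by rewrite /= rev_ordK leq_sub2lE // ltnS.
Qed.

Section SignedProjection.
Variable R : realType.

(** A linear dependence would put [o] and the [k.+1] points of [s] on a flat through [o] of
    dimension [k], which general position forbids for [k.+2] points. *)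
Lemma general_position_free d (S : seq 'rV[R]_d) o (s : seq 'rV[R]_d) :
  general_position S -> o \in S -> uniq (o :: s) -> {subset s <= S} ->
  (size s <= d)%N -> free [seq x - o | x <- s].
Proof.
move=> gen oS us sS sd; case sz: (size s) sd => [|k] kd.
  by rewrite (size0nil sz) nil_free.
apply: contraT => nf.
have oss : {subset o :: s <= S} by move=> x; rewrite inE => /predU1P[->|/sS].
case: (gen k (o :: s) kd us (congr1 succn sz) oss).
set X := [seq x - o | x <- s] in nf; have : (\dim <<X>> < k.+1)%N.
  by rewrite -sz -(size_map (fun x : 'rV_d => x - o) s) ltn_neqAle dim_span andbT; apply: nf.
rewrite ltnS => dk.
have [|W sW dW] := @vspace_dim_ext _ _ <<X>>%VS k.
  by rewrite dk dimvf /dim /= mul1n ltnW.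
exists o, W; split=> // x; rewrite inE => /predU1P[->|xs].
  by rewrite inE subrr mem0v.
by rewrite inE; apply/(subvP sW)/memv_span/map_f.
Qed.

Lemma orientation_translate d (q : 'I_d.+1 -> 'rV[R]_d) o :
  orientation (fun i => q i - o) = orientation q.
Proof.
rewrite /orientation; pose B : 'M[R]_(1 + d) := block_mx 1%:M (- o) 0 1%:M.
have B1 : \det (B : 'M_d.+1) = 1.
  by rewrite -[LHS]/(\det B) det_ublock !det1 mulr1.
have Bv (v : 'rV_d) : row_mx 1%:M v *m B = row_mx 1%:M (v - o).
  by rewrite mul_row_block !mul1mx mulmx0 addr0 mulmx1 [- o + _]addrC.
rewrite (_ : (\matrix_i _ : 'M_d.+1) = (\matrix_i (row_mx 1%:M (q i) : 'rV_d.+1)) *m B).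
  by rewrite det_mulmx B1 mulr1.
apply/row_matrixP=> i; rewrite row_mul !rowK.
exact: esym (Bv _).
Qed.

(** * Determinants under signed central projection *)

(** Scaling the homogeneous row of the projection of [p i] by the height of [p i] gives
    [(p i - o) *m H], where the columns of [H] are [nu] and the [h *: e k]. So [c] is [\det H],
    independent of [p]. *)
Lemma central_proj_det n (o nu : 'rV[R]_n.+1) (e : 'I_n -> 'rV[R]_n.+1) h :
  oriented_frame nu e -> h != 0 ->
  exists2 c, c != 0 & forall p : 'I_n.+1 -> 'rV[R]_n.+1,
    (forall i, height o nu (p i) != 0) ->
    (\prod_i height o nu (p i)) *
      \det (\matrix_i (row_mx 1%:M (central_proj o nu e h (p i)) : 'rV_n.+1)) =
    \det (\matrix_i (p i - o)) * c.
Proof.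
move=> fr h0; have [nu1 ee enu _] := fr.
pose E : 'M[R]_(n, n.+1) := \matrix_k e k.
pose H : 'M_(n.+1, 1 + n) := row_mx nu^T (h *: E^T).
have dotE (v : 'rV[R]_n.+1) k : (v *m E^T) 0 k = dotv v (e k).
  by rewrite dotvE !mxE; apply: eq_bigr => j _; rewrite !mxE.
have dotnu (v : 'rV[R]_n.+1) : v *m nu^T = (dotv v nu)%:M.
  by apply/matrixP=> i j; rewrite !ord1 -dotvE mxE mulr1n.
have vH (v : 'rV_n.+1) : v *m H = row_mx (dotv v nu)%:M (h *: (v *m E^T)).
  by rewrite mul_mx_row dotnu scalemxAr.
(* The decomposition of a vector in the frame exhibits an inverse of [H]. *)
have HK : H *m (col_mx nu (h^-1 *: E) : 'M_(1 + n, n.+1)) = 1%:M.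
  apply/row_matrixP=> i; rewrite row_mul row1.
  set v := delta_mx _ _; rewrite rowE -/v vH mul_row_col mul_scalar_mx.
  rewrite -scalemxAr -scalemxAl scalerA mulVf // scale1r addrC.
  rewrite [RHS](frame_decomp _ fr) mulmx_sum_row; congr (_ + _).
  by apply: eq_bigr => k _; rewrite dotE rowK.
exists (\det (H : 'M_n.+1)).
  apply: contra_eq_neq (congr1 determinant HK) => /= H0.
  by rewrite det_mulmx H0 mul0r det1 eq_sym oner_eq0.
move=> p p0; have := det_diag (\row_i height o nu (p i)).
under eq_bigr do rewrite mxE.
move=> <-; rewrite -!det_mulmx; congr determinant.
apply/row_matrixP=> i; rewrite !row_mul row_diag_mx rowK mxE -scalemxAl -rowE rowK.
have scE (a : R) (v : 'rV_n) : a *: row_mx 1%:M v = row_mx a%:M (a *: v).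
  by rewrite scale_row_mx scale_scalar_mx mulr1.
rewrite [LHS]scE [RHS]vH.
suff -> : height o nu (p i) *: central_proj o nu e h (p i) = h *: ((p i - o) *m E^T).
  by [].
apply/rowP=> k; rewrite [RHS]mxE dotE !mxE.
rewrite opprD addrACA subrr add0r [in LHS]dotvDl -scaleNr !dotvZl.
rewrite [dotv nu _]dotvC enu mulr0 addr0.
by rewrite mulrA mulrCA divff ?p0 // mulr1.
Qed.

Lemma sg_det_central_proj n (o nu : 'rV[R]_n.+1) (e : 'I_n -> 'rV[R]_n.+1) h
    (p p' : 'I_n.+1 -> 'rV[R]_n.+1) :
  oriented_frame nu e -> h != 0 ->
  (forall i, height o nu (p i) != 0) -> (forall i, height o nu (p' i) != 0) ->
  (forall i, proj_sign o nu (p i) = proj_sign o nu (p' i)) ->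
  orientation (fun i => central_proj o nu e h (p i)) =
    orientation (fun i => central_proj o nu e h (p' i)) ->
  Num.sg (\det (\matrix_i (p i - o))) = Num.sg (\det (\matrix_i (p' i - o))).
Proof.
move=> fr h0 p0 p0' sp op; have [c c0 cE] := central_proj_det o fr h0.
(* The sign of [c] is not known, but it occurs on both sides and cancels. *)
apply: (@mulIf _ (Num.sg c)); first by rewrite sgr_eq0.
rewrite -!sgrM -!cE // !sgrM -/(orientation _) op; congr (_ * _).
rewrite !(big_morph Num.sg (@sgrM R) (@sgr1 R)).
by apply: eq_bigr => i _; apply: sp.
Qed.

(** * Homogeneous coordinates and convex weights *)

(** Indexing columns by [unlift ord0] makes the cofactors along the column of ones reduce directly
    to minors of the [q i - o]. *)
Definition homog d (o : 'rV[R]_d) (q : 'I_d.+1 -> 'rV[R]_d) : 'M[R]_d.+1 :=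
  \matrix_(i, j) (if unlift ord0 j is Some k then (q i - o) 0 k else 1).

Lemma homog0E d (o : 'rV[R]_d) q i : homog o q i ord0 = 1.
Proof. by rewrite mxE unlift_none. Qed.

Lemma homogSE d (o : 'rV[R]_d) q i k : homog o q i (lift ord0 k) = (q i - o) 0 k.
Proof. by rewrite mxE liftK. Qed.

Lemma orientation_homog d (o : 'rV[R]_d) (q : 'I_d.+1 -> 'rV[R]_d) :
  orientation q = Num.sg (\det (homog o q)).
Proof.
rewrite -(orientation_translate q o) /orientation; congr (Num.sg (\det _)).
apply/matrixP=> i j; rewrite mxE; case: (unliftP ord0 j) => [k ->|->].
  rewrite homogSE; have -> : lift ord0 k = rshift 1 k by apply: val_inj.
  by rewrite [LHS](@row_mxEr _ 1 1 d).
have E0 : ord0 = lshift d (ord0 : 'I_1) :> 'I_(1 + d) by apply: val_inj.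
by rewrite homog0E [ord0]E0 [LHS](@row_mxEl _ 1 1 d) mxE.
Qed.

Lemma cofactor_homog d (o : 'rV[R]_d) q k :
  cofactor (homog o q) k ord0 = (-1) ^+ k * \det (\matrix_i (q (lift k i) - o)).
Proof.
rewrite /cofactor addn0; congr (_ * \det _); apply/matrixP=> i j.
by rewrite 2![LHS]mxE homogSE [RHS]mxE.
Qed.

(** The column of ones encodes that the weights sum to 1, the other columns that the weighted sum of
    the [q i - o] vanishes. *)
Lemma in_conv_homog d (o : 'rV[R]_d) (q : 'I_d.+1 -> 'rV[R]_d) :
  in_conv o q <-> exists2 w : 'rV_d.+1, (forall i, 0 <= w 0 i) &
                    w *m homog o q = delta_mx 0 ord0.
Proof.
have w1 (w : 'rV_d.+1) : (w *m homog o q) 0 ord0 = \sum_i w 0 i.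
  by rewrite mxE; apply: eq_bigr => i _; rewrite homog0E mulr1.
have wS (w : 'rV_d.+1) k : (w *m homog o q) 0 (lift ord0 k) =
    (\sum_i w 0 i *: q i - (\sum_i w 0 i) *: o) 0 k.
  rewrite mxE scaler_suml -sumrB summxE; apply: eq_bigr => i _.
  by rewrite homogSE !mxE mulrBr.
split=> [[w [w0 sw ow]]|[w w0 wM]].
  exists (\row_i w i) => [i|]; first by rewrite mxE.
  apply/rowP=> j; case: (unliftP ord0 j) => [k ->|->].
    rewrite wS [RHS]mxE; under eq_bigr do rewrite mxE.
    by under [X in X *: o]eq_bigr do rewrite mxE; rewrite sw -ow scale1r subrr mxE.
  by rewrite w1 [RHS]mxE; under eq_bigr do rewrite mxE.
have sw : \sum_i w 0 i = 1 by rewrite -w1 wM mxE.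
exists (w 0); split=> //; apply/esym/eqP; rewrite -subr_eq0; apply/eqP/rowP=> k.
by rewrite -[o in LHS]scale1r -sw -wS wM !mxE.
Qed.

(** Cramer's rule: multiply the hypothesis on the right by the adjugate. The determinant may be zero
    here. *)
Lemma convex_cofactor d (o : 'rV[R]_d) q (w : 'rV_d.+1) k :
  w *m homog o q = delta_mx 0 ord0 ->
  cofactor (homog o q) k ord0 = \det (homog o q) * w 0 k.
Proof.
move=> wM; have := congr1 (mulmx^~ (\adj (homog o q))) wM.
rewrite -mulmxA mul_mx_adj mul_mx_scalar -rowE => /rowP/(_ k).
by rewrite !mxE => ->.
Qed.

(** * Nonvanishing determinants from general position *)

(** Since [q] may repeat points, the weights are first collected by position in [s]. Freeness would
    make every collected weight zero, while their total is 1. *)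
Lemma in_conv_nfree d m (o : 'rV[R]_d) (q : 'I_m -> 'rV[R]_d) s :
  in_conv o q -> {subset codom q <= s} -> ~~ free [seq x - o | x <- s].
Proof.
move=> [w [_ w1 ow]] qs; apply/negP=> fs.
have qs_lt j : (index (q j) s < size s)%N by rewrite index_mem qs ?codom_f.
pose f j := Ordinal (qs_lt j).
have /freeP w0 : free (map_tuple (fun x => x - o) (in_tuple s)) := fs.
have {}w0 i : \sum_(j | f j == i) w j = 0.
  apply: (w0 (fun i => \sum_(j | f j == i) w j)) i.
  transitivity (\sum_j w j *: (q j - o)).
    rewrite [RHS](partition_big f xpredT) //=.
    apply: eq_bigr => i _; rewrite scaler_suml; apply: eq_bigr => j /eqP <-.
    by rewrite (nth_map 0) // nth_index ?qs ?codom_f.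
  by under eq_bigr do rewrite scalerBr; rewrite sumrB -scaler_suml w1 -ow scale1r subrr.
have := oner_neq0 R; rewrite -w1 (partition_big f xpredT) //=.
by rewrite big1 ?eqxx.
Qed.

Lemma free_det_neq0 d (v : 'I_d -> 'rV[R]_d) :
  free (codom v) -> \det (\matrix_i v i) != 0.
Proof.
rewrite (_ : codom v = map_tuple v (ord_tuple d)); last by rewrite codomE.
move/freeP=> fv; rewrite -unitfE -[_ \is a _]/(_ \in unitmx) -row_free_unit.
apply: inj_row_free => u u0; apply/rowP=> i; rewrite mxE.
apply: (fv (u 0)) i; rewrite -[RHS]u0 mulmx_sum_row; apply: eq_bigr => i _.
by rewrite rowK -tnth_nth tnth_map tnth_ord_tuple.
Qed.

(* General position constrains only the set of points, so repetitions in q have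
   to be excluded: they would put o in the affine span of too few points. *)
Lemma det_homog_neq0 n (S : seq 'rV[R]_n.+1) o (q : 'I_n.+2 -> 'rV[R]_n.+1) :
  general_position S -> o \in S -> {subset codom q <= S} ->
  o \notin codom q -> in_conv o q -> \det (homog o q) != 0.
Proof.
move=> gen oS qS oq oc.
(* With at most [n.+1] distinct points, their differences with [o] would be free, contradicting
   [oc]. *)
have [sq|sq] := leqP (size (undup (codom q))) n.+1.
  suff fq : free [seq x - o | x <- undup (codom q)].
    suff /(in_conv_nfree oc)/negP[] : {subset codom q <= undup (codom q)} by [].
    by move=> x; rewrite mem_undup.
  apply: (general_position_free gen oS _ _ sq).
    by rewrite /= mem_undup oq undup_uniq.
  by move=> x; rewrite mem_undup; apply: qS.
have uq : uniq (codom q).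
  by rewrite -[uniq _]negbK -ltn_size_undup size_codom card_ord -leqNgt.
have /in_conv_homog[w w0 wM] := oc.
(* For distinct points, this cofactor is a minor on [n.+1] differences, nonzero by general position,
   and it has [\det (homog o q)] as a factor. *)
suff : cofactor (homog o q) ord0 ord0 != 0.
  by rewrite (convex_cofactor _ wM) mulf_eq0 negb_or => /andP[].
rewrite cofactor_homog mul1r; apply: free_det_neq0.
rewrite (_ : codom _ = [seq x - o | x <- codom (q \o lift ord0)]); last first.
  exact: (map_comp (fun x => x - o)).
have sub : {subset codom (q \o lift ord0) <= codom q}.
  by move=> _ /codomP[i ->]; apply: codom_f.
apply: (general_position_free gen oS).
- rewrite /= (contra (@sub o)) //=.
  apply/injectiveP => i j /= /(injectiveP _ uq); exact: lift_inj.
- by move=> x /sub /qS.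
- by rewrite size_codom card_ord.
Qed.

End SignedProjection.

Theorem theorem7 (R : realType) (n : nat)
    (q q' : 'I_n.+2 -> 'rV[R]_n.+1)
    (o nu : 'rV[R]_n.+1) (e : 'I_n -> 'rV[R]_n.+1) (h : R)
    (hframe : oriented_frame nu e) (hh : 0 < h)
    (hgen : general_position (o :: codom q ++ codom q'))
    (hq : forall i, height o nu (q i) != 0)
    (hq' : forall i, height o nu (q' i) != 0)
    (hconv : in_conv o q)
    (hproj : same_order_type (fun i => central_proj o nu e h (q i))
                             (fun i => central_proj o nu e h (q' i)))
    (hsign : forall i, proj_sign o nu (q i) = proj_sign o nu (q' i)) :
  in_conv o q' /\ same_order_type q q'.
Proof.
(* The height of [o] itself is zero. *)
have oq : o \notin codom q.
  apply/codomP=> -[i oi]; have := hq i.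
  by rewrite -oi /height subrr /dotv big1 ?eqxx // => j _; rewrite mxE mul0r.
have qS : {subset codom q <= o :: codom q ++ codom q'}.
  by move=> x xq; rewrite inE mem_cat xq orbT.
have M0 := det_homog_neq0 hgen (mem_head _ _) qS oq hconv.
have /in_conv_homog[w w0 wM] := hconv.
set M := homog o q in M0 wM; pose M' := homog o q'.
have w1 : \sum_i w 0 i = 1.
  transitivity ((w *m M) 0 ord0); last by rewrite wM mxE.
  by rewrite mxE; apply: eq_bigr => i _; rewrite homog0E mulr1.
have sgC k : Num.sg (cofactor M' k ord0) = Num.sg (\det M) * Num.sg (w 0 k).
  rewrite -sgrM -(convex_cofactor _ wM) !cofactor_homog !sgrM; congr (_ * _).
  apply/esym; apply: (sg_det_central_proj hframe (lt0r_neq0 hh)) => [i|i|i|].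
  - exact: hq.
  - exact: hq'.
  - exact: hsign.
  (* [lift k] lists the indices other than [k] in increasing order. *)
  - by apply: (hproj (lift k)) => i j; rewrite !ltnNge leq_bump2.
pose C k := Num.sg (\det M) * cofactor M' k ord0.
have C0 k : 0 <= C k.
  by rewrite -sgr_ge0 sgrM sgC sgr_id mulrA -expr2 sqr_sg M0 mul1r sgr_ge0.
have CE : Num.sg (\det M) * \det M' = \sum_k C k.
  rewrite (expand_det_col M' ord0) mulr_sumr; apply: eq_bigr => k _.
  by rewrite homog0E mul1r.
have detM' : 0 < Num.sg (\det M) * \det M'.
  (* If the sum were zero, every [C k], and with it every [w 0 k], would vanish, contradicting
     [w1]. *)
  rewrite CE lt0r sumr_ge0 // andbT; apply/eqP=> /psumr_eq0P Ceq.
  have := oner_neq0 R; rewrite -w1 big1 ?eqxx // => k _.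
  apply/eqP; rewrite -sgr_eq0; apply/eqP.
  have /eqP := Ceq (fun i _ => C0 i) k isT.
  rewrite -sgr_eq0 sgrM sgC sgr_id mulrA -expr2 sqr_sg M0 mul1r.
  by move/eqP.
have sgM : Num.sg (\det M') = Num.sg (\det M).
  have /gtr0_sg := detM'; rewrite sgrM sgr_id => /(congr1 ( *%R (Num.sg (\det M)))).
  by rewrite mulrA -expr2 sqr_sg M0 mul1r mulr1.
split; last first.
  move=> f /incr_ord_id f_id.
  have qE (p : 'I_n.+2 -> 'rV[R]_n.+1) : orientation (fun i => p (f i)) = orientation p.
    by congr (Num.sg (\det _)); apply/row_matrixP=> i; rewrite !rowK f_id.
  by rewrite !qE !(orientation_homog o) sgM.
(* Row [ord0] of the adjugate consists of the cofactors along the column of ones; dividing by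
   [\det M'] makes them nonnegative with sum 1. *)
apply/in_conv_homog; exists ((\det M')^-1 *: row ord0 (\adj M')) => [k|].
  by rewrite !mxE -sgr_ge0 sgrM sgrV sgM sgC mulrA -expr2 sqr_sg M0 mul1r sgr_ge0.
rewrite -scalemxAl -row_mul mul_adj_mx rowE mul_mx_scalar scalerA mulVf ?scale1r //.
by apply: contraTneq detM' => ->; rewrite mulr0 ltxx.
Qed.
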